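(* The mapping $\psi\mapsto f$, where $f(z):=\langle k(\cdot,z),\psi\rangle_{\mathcal{F}}$ for $z\in\mathbb{C}$, is a bijection between $\mathcal{F}_{-1}$ and $\operatorname{assoc}\mathcal{B}$.
   Context: Inner products are conjugate linear in the left argument. For an entire function $f$, $f^\#(z):=\overline{f(\overline z)}$. A Hilbert space of entire functions is a de Branges (dB) space if it has a reproducing kernel and is isometrically invariant under $f\mapsto f^\#$ and under $f(z)\mapsto \frac{z-\overline w}{z-w}f(z)$ whenever $w$ is a non-real zero of $f$. The Hermite-Biehler class consists of entire $e$ with $|e(z)|>|e(\overline z)|$ for all $z$ with $\operatorname{Im} z>0$; for such $e$, $\mathcal{B}(e)$ is the space of entire $f$ with $f/e,\,f^\#/e\in H^2(\mathbb{C}_+)$ (Hardy space of the upper half plane), with inner product $\langle f,g\rangle=\int_{\mathbb{R}}\frac{\overline{f(x)}g(x)}{|e(x)|^2}dx$. Every nonzero dB space equals some $\mathcal{B}(e)$ isometrically. Fix a nonzero dB space $\mathcal{B}=\mathcal{B}(e)$ with $e$ in the Hermite-Biehler class and without real zeros (standing assumption). Its reproducing kernel is $k(z,w)$, so $f(w)=\langle k(\cdot,w),f\rangle$ for $f\in\mathcal{B}$. The set $\operatorname{assoc}\mathcal{B}$ of associated functions consists of the entire functions $h$ such that $\frac{h(w)f(z)-h(z)f(w)}{z-w}\in\mathcal{B}$ for all $f\in\mathcal{B}$ and all $w$ with $h(w)\neq0$; equivalently $\operatorname{assoc}\mathcal{B}=z\mathcal{B}+\mathcal{B}$. $S$ is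 the operator of multiplication by the independent variable on its maximal domain in $\mathcal{B}$; it is assumed throughout that $\operatorname{dom}(S)$ is dense. One has $k(\cdot,w)\in\ker(S^*-\overline wI)$ for every $w\in\mathbb{C}$. $\mathcal{F}_{+1}$ is $\operatorname{dom}(S^* )$ with inner product $\langle f,g\rangle_{+\mathcal{F}}:=\langle S^*f,S^*g\rangle+\langle f,g\rangle$. $\mathcal{F}_{-1}$ is its dual, realized as the completion of $\mathcal{B}$ with respect to $\|f\|_{-\mathcal{F}}:=\sup_{g\in\operatorname{dom}(S^* )\setminus\{0\}}\frac{|\langle f,g\rangle|}{\|g\|_{+\mathcal{F}}}$. The pairing $\langle\cdot,\cdot\rangle_{\mathcal{F}}:\mathcal{F}_{-1}\times\mathcal{F}_{+1}\to\mathbb{C}$ is the continuous extension of the inner product of $\mathcal{B}$, and $\langle f,\phi\rangle_{\mathcal{F}}:=\overline{\langle\phi,f\rangle_{\mathcal{F}}}$ for $f\in\mathcal{F}_{+1}$, $\phi\in\mathcal{F}_{-1}$. *)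

(* Defs.v *)
From mathcomp Require Import all_boot all_order all_algebra.
From mathcomp Require Import complex.
From mathcomp Require Import all_classical all_reals all_analysis.

Set Implicit Arguments.
Unset Strict Implicit.
Unset Printing Implicit Defensive.

Import Order.TTheory GRing.Theory Num.Theory.
Import numFieldNormedType.Exports.

Local Open Scope classical_set_scope.
Local Open Scope ring_scope.
Local Open Scope complex_scope.

Section EntireFunctions.
Context {R : realType}.
Local Notation C := R[i].
Implicit Types (f g h e : C -> C) (B : set (C -> C)).

(* The norm of [R[i]] takes its (real) values in [R[i]]; this is its
   [R]-valued counterpart. *)
Definition cabs (z : C) : R := complex.Re `|z|.

Definition holomorphic_at f (z : C) : Prop :=
  derivable (f : C^o -> C^o) z 1.

Definition entire f : Prop := forall z : C, holomorphic_at f z.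

Definition sharp f : C -> C := fun z => (f z^*)^*.

Definition cintegral (F : R -> C) : C :=
  (\int[lebesgue_measure]_x complex.Re (F x))
    +i* (\int[lebesgue_measure]_x complex.Im (F x)).

(* Only the values of [f] on the open upper half plane matter. *)
Definition hardy2 f : Prop :=
  (forall z : C, 0 < complex.Im z -> holomorphic_at f z) /\
  exists M : R, forall y : R, 0 < y ->
    (\int[lebesgue_measure]_x ((cabs (f (x +i* y))) ^+ 2)%:E <= M%:E)%E.

Definition hermite_biehler e : Prop :=
  entire e /\
  forall z : C, 0 < complex.Im z -> `|e z^*| < `|e z|.

Definition no_real_zeros e : Prop := forall x : R, e x%:C != 0.

Definition dB_of e : set (C -> C) :=
  [set f | [/\ entire f,
               hardy2 (fun z => f z / e z) &
               hardy2 (fun z => sharp f z / e z)]].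

Definition dB_inner e f g : C :=
  cintegral (fun x : R => (f x%:C)^* * g x%:C / (`|e x%:C| ^+ 2)).

End EntireFunctions.

Section DeBranges.
Context {R : realType}.
Local Notation C := R[i].
(* A space of functions is given by its carrier [B] together with an inner
   product [ip], of which only the values on [B] are relevant. *)
Context (B : set (C -> C)) (ip : (C -> C) -> (C -> C) -> C).
Implicit Types (f g h u : C -> C) (z w a : C).

Definition hnorm f : R := Num.sqrt (complex.Re (ip f f)).

Record is_hilbert : Prop := {
  hilbert_zero : B (fun=> 0);
  hilbert_lin : forall a f g, B f -> B g -> B (fun z => a * f z + g z);
  hilbert_ip_lin : forall f a g h, B f -> B g -> B h ->
    ip f (fun z => a * g z + h z) = a * ip f g + ip f h;
  hilbert_ip_conj : forall f g, B f -> B g -> ip g f = (ip f g)^*;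
  (* in [R[i]], [0 < c] says that [c] is real and positive *)
  hilbert_ip_pos : forall f, B f -> f <> (fun=> 0) -> 0 < ip f f;
  hilbert_complete : forall f_ : nat -> C -> C, (forall n, B (f_ n)) ->
    (forall eps : R, 0 < eps -> exists N, forall m n, (N <= m)%N -> (N <= n)%N ->
       hnorm (fun z => f_ m z - f_ n z) < eps) ->
    exists2 f, B f &
      (fun n => hnorm (fun z => f_ n z - f z)) @ \oo --> (0 : R) }.

Definition reproducing_kernel (k : C -> C -> C) : Prop :=
  forall w, B (k^~ w) /\ forall f, B f -> f w = ip (k^~ w) f.

(* The function z |-> (z - w^* ) / (z - w) * f z has a removable singularity at
   the zero w of f; it is the entire g with (z - w) g(z) = (z - w^* ) f(z). *)
Record is_dB_space : Prop := {
  dB_entire : forall f, B f -> entire f;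
  dB_hilbert : is_hilbert;
  dB_kernel : exists k, reproducing_kernel k;
  dB_sharp : forall f, B f -> B (sharp f) /\ hnorm (sharp f) = hnorm f;
  dB_factor : forall f w, B f -> complex.Im w != 0 -> f w = 0 ->
    exists g, [/\ B g, forall z, (z - w) * g z = (z - w^*) * f z &
                  hnorm g = hnorm f] }.

(* As above, the difference quotient is taken by continuity at z = w. *)
Definition assoc : set (C -> C) :=
  [set h | entire h /\
     forall f w, B f -> h w != 0 ->
       exists2 g, B g & forall z, (z - w) * g z = h w * f z - h z * f w].

Definition mulz f : C -> C := fun z => z * f z.

Definition domS : set (C -> C) := [set f | B f /\ B (mulz f)].

Definition densely_defined : Prop :=
  forall f (eps : R), B f -> 0 < eps ->
    exists2 u, domS u & hnorm (fun z => f z - u z) < eps.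

(* [h] is a value of the adjoint S^* at [f]; it is unique when [domS] is
   dense. *)
Definition adjoint_val f h : Prop :=
  B h /\ forall u, domS u -> ip f (mulz u) = ip h u.

Definition domSstar : set (C -> C) := [set f | B f /\ exists h, adjoint_val f h].

Definition Sstar f : C -> C := xget (fun=> 0) [set h | adjoint_val f h].

Definition plus_inner f g : C := ip (Sstar f) (Sstar g) + ip f g.

Definition plus_norm f : R := Num.sqrt (complex.Re (plus_inner f f)).

Definition minus_norm f : R :=
  sup [set r | exists g, [/\ domSstar g, g <> (fun=> 0) &
                             r = cabs (ip f g) / plus_norm g]].

Record is_completion (X : completeNormedModType C) (iota : (C -> C) -> X)
    : Prop := {
  completion_lin : forall a f g, B f -> B g ->
    iota (fun z => a * f z + g z) = a *: iota f + iota g;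
  completion_norm : forall f, B f -> `|iota f| = (minus_norm f)%:C;
  completion_dense : dense (iota @` B) }.

(* [pair] is only relevant on X * dom(S^* ); the continuity is joint, for the
   norm of [X] and the norm [plus_norm]. *)
Record is_pairing (X : completeNormedModType C) (iota : (C -> C) -> X)
    (pair : X -> (C -> C) -> C) : Prop := {
  pairing_ext : forall f g, B f -> domSstar g -> pair (iota f) g = ip f g;
  pairing_continuous : forall (psi0 : X) g0, domSstar g0 ->
    forall eps : R, 0 < eps -> exists2 delta : R, 0 < delta &
    forall (psi : X) g, domSstar g ->
      `|psi - psi0| < delta%:C -> plus_norm (fun z => g z - g0 z) < delta ->
      `|pair psi g - pair psi0 g0| < eps%:C }.

Definition pairing_rev (X : Type) (pair : X -> (C -> C) -> C)
    f (psi : X) : C := (pair psi f)^*.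

End DeBranges.

(* Main.v *)
Require Import Defs.
From mathcomp Require Import all_boot all_order all_algebra.
From mathcomp Require Import complex.
From mathcomp Require Import all_classical all_reals all_analysis.
From mathcomp Require Import measurable_realfun.
From mathcomp Require Import ring lra.

Set Implicit Arguments.
Unset Strict Implicit.
Unset Printing Implicit Defensive.

Import Order.TTheory GRing.Theory Num.Theory.
Import numFieldNormedType.Exports.

Local Open Scope classical_set_scope.
Local Open Scope ring_scope.
Local Open Scope complex_scope.
(* Without this, the notation would denote [conjc] or [Num.conj] depending on
   the expected type. *)
Local Notation "x ^*" := (conjc x) : ring_scope.

(** Every [psi] in the dual of dom(S^* ) with its graph norm is represented, by
    Riesz, by some [u] in dom(S^* ): the pairing of [psi] with [g] is
    <S^* u, S^* g> + <u, g>. As [S^*] multiplies the kernel [k(., z)] by [conj z],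
    the function attached to [psi] is [f(z) = z (S^* u)(z) + u(z)]
    ([plus_inner_kernel]), an element of [z B + B].

    Injectivity ([pair_kernel_inj]) says that the kernels are total in the graph
    space: if [z S^* u + u = 0], then [S^* u] lies in the domain of [S] and
    [S S^* u = - u], so ||S^* u||^2 + ||u||^2 = 0.

    Surjectivity onto [z B + B] ([pair_kernel_surj]) uses the density of dom(S):
    for [a_n] in dom(S) tending to [a], the functions [z a_n + b] of [B] satisfy
    <z a_n, g> = <a_n, S^* g>, hence are Cauchy for the dual norm, and their limit
    is mapped to [z a + b].

    The remaining point is that the associated functions are [z B + B]
    ([assoc_lin_mulz], [assoc_decomp]). It rests on the division of a function of
    [B] by [z - w] at a zero [w]. For non-real [w] this is an axiom of de Branges
    spaces. For real [w] ([divide_real]) one divides at [w + i t], with a correction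
    removing the pole, and lets [t] tend to 0: the quotients are bounded in norm
    because [e] has no zero at [w] ([quotient_bounded]), so that the inner product
    of the function to be divided with [l] is at most a multiple of ||(S^* - w) l||,
    and the Riesz representative of this functional is the quotient. One form of the Riesz theorem ([riesz]) serves for both uses. *)

(** * Complex modulus *)

Section ComplexModulus.
Context {R : realType}.
Local Notation C := R[i].
Implicit Types (z w : C) (x : R).

Lemma cabsE z : (cabs z)%:C = `|z|.
Proof. by []. Qed.

Lemma realcD x y : (x + y)%:C = x%:C + y%:C :> C.
Proof. exact: rmorphD. Qed.

Lemma realcM x y : (x * y)%:C = x%:C * y%:C :> C.
Proof. exact: rmorphM. Qed.

Lemma gt0_real_complex z : 0 < z -> z = (complex.Re z)%:C.
Proof. by rewrite ltcE; case: z => x y /= /andP[/eqP -> _]. Qed.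

Lemma cabs_ge0 z : 0 <= cabs z.
Proof. by rewrite -ler0c cabsE. Qed.

Lemma cabsM z w : cabs (z * w) = cabs z * cabs w.
Proof. exact: ComplexField.Normc.normcM. Qed.

Lemma cabsV z : cabs z^-1 = (cabs z)^-1.
Proof. exact: ComplexField.Normc.normcV. Qed.

Lemma cabsD z w : cabs (z + w) <= cabs z + cabs w.
Proof. by rewrite -lecR rmorphD /= !cabsE ler_normD. Qed.

Lemma cabsN z : cabs (- z) = cabs z.
Proof. by rewrite /cabs normrN. Qed.

Lemma cabsB z w : cabs (z - w) <= cabs z + cabs w.
Proof. by rewrite -(cabsN w) cabsD. Qed.

Lemma cabsC z w : cabs (z - w) = cabs (w - z).
Proof. by rewrite /cabs distrC. Qed.

Lemma cabs0 : cabs (0 : C) = 0.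
Proof. by rewrite /cabs normr0. Qed.

Lemma cabs0_eq0 z : cabs z = 0 -> z = 0.
Proof. by move=> z0; apply/normr0_eq0; rewrite -cabsE z0. Qed.

Lemma cabs_gt0 z : z != 0 -> 0 < cabs z.
Proof.
by move=> z0; rewrite lt_neqAle cabs_ge0 andbT eq_sym; apply: contra_neq z0 => /cabs0_eq0.
Qed.

Lemma cabsJ z : cabs z^* = cabs z.
Proof. by rewrite /cabs normcJ. Qed.

Lemma cabsR x : cabs x%:C = `|x|.
Proof. by rewrite /cabs normc_def /= expr0n /= addr0 sqrtr_sqr. Qed.

Lemma ler_Re_cabs z : `|complex.Re z| <= cabs z.
Proof. by rewrite -lecR; exact: normc_ge_Re. Qed.

Lemma ler_Im_cabs z : `|complex.Im z| <= cabs z.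
Proof.
rewrite -(normrN (complex.Im z)) -ReiNIm (le_trans (ler_Re_cabs _)) // cabsM.
by rewrite /cabs !normc_def /= expr0n /= expr1n add0r sqrtr1 mulr1.
Qed.

Lemma mulJc z : z^* * z = ((cabs z) ^+ 2)%:C.
Proof. by rewrite mulrC -sqr_normc rmorphXn /= cabsE. Qed.

Lemma Re_variation (t : R) z : complex.Re (- t%:C * z^* * z) = - (t * cabs z ^+ 2).
Proof. by rewrite -mulrA mulJc mulNr -realcM. Qed.

Lemma cabs_variation (t : R) z : cabs (- t%:C * z^*) ^+ 2 = t ^+ 2 * cabs z ^+ 2.
Proof. by rewrite cabsM cabsN cabsJ cabsR exprMn real_normK ?num_real. Qed.

Lemma inv_succ_small (eps : R) : 0 < eps ->
  exists N, forall n, (N <= n)%N -> n.+1%:R^-1 < eps.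
Proof.
move=> e0; have [N hN] := ltr_add_invr e0.
exists N => n Nn; rewrite add0r in hN; apply: le_lt_trans hN.
by rewrite lef_pV2 ?posrE ?ltr0n // ler_nat.
Qed.

(** Equality of complex numbers is obtained below from arbitrarily good
    approximations; the factor [K] absorbs the constants of the estimates. *)
Lemma cabs_small_eq0 z (K : R) :
  (forall eps : R, 0 < eps -> cabs z <= eps * K) -> z = 0.
Proof.
move=> h; apply: cabs0_eq0; apply/eqP; rewrite eq_le cabs_ge0 andbT.
rewrite leNgt; apply/negP => z0.
have K0 : 0 < K.
  rewrite ltNge; apply/negP => K0.
  have := h 1 ltr01; rewrite mul1r leNgt => /negP; apply.
  exact: le_lt_trans z0.
have e0 : 0 < cabs z / 2 / K by rewrite !divr_gt0.
have := h _ e0; rewrite divfK ?gt_eqF // leNgt => /negP; apply.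
by rewrite ltr_pdivrMr // ltr_pMr // ltr1n.
Qed.

(** A quadratic polynomial with nonnegative values has nonpositive
    discriminant, in the form taken by the variations below. *)
Lemma quadratic_ge0 (c d n : R) :
  (forall t : R, 0 <= d - 2 * t * c ^+ 2 + t ^+ 2 * c ^+ 2 * n ^+ 2) ->
  c ^+ 2 <= d * n ^+ 2.
Proof.
move=> h; have [n0|n0] := eqVneq n 0.
  have [->|c0] := eqVneq c 0; first by rewrite n0 expr0n /= mulr0.
  have := h ((d + 1) / (2 * c ^+ 2)).
  have -> : d - 2 * ((d + 1) / (2 * c ^+ 2)) * c ^+ 2 +
      ((d + 1) / (2 * c ^+ 2)) ^+ 2 * c ^+ 2 * n ^+ 2 = -1.
    by rewrite n0; field.
  by rewrite oppr_ge0 ler10.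
have := h (n ^- 2).
have -> : d - 2 * n ^- 2 * c ^+ 2 + (n ^- 2) ^+ 2 * c ^+ 2 * n ^+ 2 =
   d - c ^+ 2 / n ^+ 2 by field.
by rewrite subr_ge0 ler_pdivrMr // exprn_even_gt0.
Qed.

End ComplexModulus.

(** * Hilbert spaces of functions and the Riesz theorem *)

Section HilbertSpace.
Context {R : realType} {D : set (R[i] -> R[i])}.
Context {ip : (R[i] -> R[i]) -> (R[i] -> R[i]) -> R[i]}.
Hypothesis H : is_hilbert D ip.
Local Notation C := R[i].
Implicit Types (f g h : C -> C) (a : C).

Lemma spaceZ a f : D f -> D (fun z => a * f z).
Proof.
move=> Df; have := hilbert_lin H a Df (hilbert_zero H).
by under eq_fun do rewrite addr0.
Qed.

Lemma spaceD f g : D f -> D g -> D (fun z => f z + g z).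
Proof.
move=> Df Dg; have := hilbert_lin H 1 Df Dg.
by under eq_fun do rewrite mul1r.
Qed.

Lemma subE f g : (fun z => f z - g z) = (fun z => (-1) * g z + f z).
Proof. by apply/funext => z; rewrite mulN1r addrC. Qed.

Lemma spaceB f g : D f -> D g -> D (fun z => f z - g z).
Proof. by move=> Df Dg; rewrite subE; exact: (hilbert_lin H). Qed.

Lemma ip0r f : D f -> ip f (fun=> 0) = 0.
Proof.
move=> Df; have := hilbert_ip_lin H 1 Df (hilbert_zero H) (hilbert_zero H).
rewrite (_ : (fun=> _) = (fun=> 0)); last first.
  by apply/funext => z; rewrite mulr0 addr0.
by rewrite mul1r -[X in X = _]addr0 => /addrI <-.
Qed.

Lemma ipZr a f g : D f -> D g -> ip f (fun z => a * g z) = a * ip f g.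
Proof.
move=> Df Dg; have := hilbert_ip_lin H a Df Dg (hilbert_zero H).
by under eq_fun do rewrite addr0; rewrite ip0r // addr0.
Qed.

Lemma ipBr f g h : D f -> D g -> D h ->
  ip f (fun z => g z - h z) = ip f g - ip f h.
Proof. by move=> *; rewrite subE (hilbert_ip_lin H) // mulN1r addrC. Qed.

Lemma ip_linl a f g h : D f -> D g -> D h ->
  ip (fun z => a * g z + h z) f = a^* * ip g f + ip h f.
Proof.
move=> Df Dg Dh; rewrite (hilbert_ip_conj H Df) ?(hilbert_ip_lin H) //; last exact: (hilbert_lin H).
by rewrite rmorphD rmorphM /= -!(hilbert_ip_conj H).
Qed.

Lemma ipZl a f g : D f -> D g -> ip (fun z => a * g z) f = a^* * ip g f.
Proof.
move=> Df Dg; rewrite (hilbert_ip_conj H Df) ?ipZr //; last exact: spaceZ.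
by rewrite rmorphM /= -(hilbert_ip_conj H).
Qed.

Lemma ipBl f g h : D f -> D g -> D h ->
  ip (fun z => g z - h z) f = ip g f - ip h f.
Proof. by move=> *; rewrite subE ip_linl // rmorphN rmorph1 mulN1r addrC. Qed.

Lemma ip_self f : D f -> ip f f = ((hnorm ip f) ^+ 2)%:C.
Proof.
move=> Df; have [->|f0] := pselect (f = fun=> 0).
  by rewrite /hnorm ip0r ?sqrtr0 ?expr0n //; exact: hilbert_zero H.
have := hilbert_ip_pos H Df f0; rewrite /hnorm.
case: (ip f f) => x y; rewrite ltcE /= => /andP[/eqP -> x0].
by rewrite sqr_sqrtr // ltW.
Qed.

Lemma hnorm_ge0 f : 0 <= hnorm ip f.
Proof. exact: sqrtr_ge0. Qed.

Lemma hnorm0_eq0 f : D f -> hnorm ip f = 0 -> f = fun=> 0.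
Proof.
move=> Df f0; apply: contrapT => nf.
have := hilbert_ip_pos H Df nf.
by rewrite ip_self // f0 expr0n ltxx.
Qed.

Lemma hnorm0 : hnorm ip (fun=> 0) = 0.
Proof. by rewrite /hnorm ip0r ?sqrtr0 //; exact: hilbert_zero H. Qed.

Lemma hnorm_expand a f g : D f -> D g ->
  hnorm ip (fun z => a * g z + f z) ^+ 2 =
  hnorm ip f ^+ 2 + 2 * complex.Re (a * ip f g) + cabs a ^+ 2 * hnorm ip g ^+ 2.
Proof.
move=> Df Dg; have Dh := hilbert_lin H a Dg Df.
apply: complexI; rewrite -(ip_self Dh) // (hilbert_ip_lin H) // !ip_linl //.
rewrite (hilbert_ip_conj H Df Dg) !ip_self //.
set r := complex.Re _; have er : r%:C = (a * ip f g + (a * ip f g)^*) / 2%:R by exact: ReJ_add.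
rewrite 2!realcD (realcM 2 r) (realcM (cabs a ^+ 2)) -mulJc er !rmorphM /=.
by field.
Qed.

Lemma cauchy_schwarz f g : D f -> D g ->
  cabs (ip f g) <= hnorm ip f * hnorm ip g.
Proof.
move=> Df Dg; rewrite -(@ler_pXn2r _ 2) ?nnegrE ?cabs_ge0 ?mulr_ge0 ?hnorm_ge0 //.
rewrite exprMn; apply: quadratic_ge0 => t.
have := sqr_ge0 (hnorm ip (fun z => (- t%:C * (ip f g)^*) * g z + f z)).
rewrite hnorm_expand // Re_variation cabs_variation.
by congr (0 <= _); ring.
Qed.

Lemma hnorm_scale a f : D f -> hnorm ip (fun z => a * f z) = cabs a * hnorm ip f.
Proof.
move=> Df; apply/eqP; rewrite -(@eqrXn2 _ 2) ?mulr_ge0 ?cabs_ge0 ?hnorm_ge0 //.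
have := hnorm_expand a (hilbert_zero H) Df.
under eq_fun do rewrite addr0.
rewrite (hilbert_ip_conj H Df (hilbert_zero H)) ip0r // hnorm0 => ->.
by rewrite conjc0 mulr0 /= expr0n /= add0r mulr0 add0r exprMn.
Qed.

Lemma hnorm_add f g : D f -> D g ->
  hnorm ip (fun z => f z + g z) <= hnorm ip f + hnorm ip g.
Proof.
move=> Df Dg; rewrite -(@ler_pXn2r _ 2) ?nnegrE ?addr_ge0 ?hnorm_ge0 //.
have := hnorm_expand 1 Dg Df.
rewrite (_ : (fun z => _) = fun z => f z + g z); last first.
  by apply/funext => z; rewrite mul1r.
move=> ->; rewrite mul1r cabsR normr1 expr1n mul1r sqrrD.
have : complex.Re (ip g f) <= hnorm ip f * hnorm ip g.
  apply: le_trans (ler_norm _) _; apply: le_trans (ler_Re_cabs _) _.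
  by rewrite mulrC cauchy_schwarz.
by move=> ?; lra.
Qed.

Lemma hnorm_subC f g : D f -> D g ->
  hnorm ip (fun z => f z - g z) = hnorm ip (fun z => g z - f z).
Proof.
move=> Df Dg; rewrite (_ : (fun z => f z - g z) = fun z => (-1) * (g z - f z)).
  by rewrite hnorm_scale ?cabsN ?cabsR ?normr1 ?mul1r //; exact: spaceB.
by apply/funext => z; rewrite mulN1r opprB.
Qed.

Lemma hnorm_sub f g : D f -> D g ->
  hnorm ip (fun z => f z - g z) <= hnorm ip f + hnorm ip g.
Proof.
move=> Df Dg; rewrite (_ : (fun z => _) = fun z => f z + (-1) * g z).
  apply: le_trans (hnorm_add Df (spaceZ _ Dg)) _.
  by rewrite hnorm_scale // cabsN cabsR normr1 mul1r.
by apply/funext => z; rewrite mulN1r.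
Qed.

Lemma hnorm_triangle h f g : D f -> D g -> D h ->
  hnorm ip (fun z => f z - g z) <=
  hnorm ip (fun z => f z - h z) + hnorm ip (fun z => h z - g z).
Proof.
move=> Df Dg Dh; rewrite (_ : (fun z => f z - g z) = fun z => (f z - h z) + (h z - g z)).
  by apply: hnorm_add; exact: spaceB.
by apply/funext => z; rewrite addrA subrK.
Qed.

Section Riesz.
Context (L : set (C -> C)) (A : (C -> C) -> C -> C) (phi : (C -> C) -> C) (M : R).
Hypothesis L0 : L (fun=> 0).
Hypothesis L_lin : forall a f g, L f -> L g -> L (fun z => a * f z + g z).
Hypothesis A_D : forall f, L f -> D (A f).
Hypothesis A_lin : forall a f g, L f -> L g ->
  A (fun z => a * f z + g z) = fun z => a * A f z + A g z.
Hypothesis phi_lin : forall a f g, L f -> L g ->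
  phi (fun z => a * f z + g z) = a * phi f + phi g.
Hypothesis phi_bnd : forall f, L f -> cabs (phi f) <= M * hnorm ip (A f).

Let energy f := hnorm ip (A f) ^+ 2 - 2 * complex.Re (phi f).

Let energy_lb f : L f -> - M ^+ 2 <= energy f.
Proof.
move=> Lf; have := le_trans (ler_norm _) (le_trans (ler_Re_cabs _) (phi_bnd Lf)).
have := sqr_ge0 (hnorm ip (A f) - M); rewrite /energy => h1 h2.
have : 2 * (complex.Re (phi f)) <= 2 * (M * hnorm ip (A f)) by rewrite ler_pM2l.
by move: h1; rewrite sqrrB => ? ?; lra.
Qed.

(** Varying a near-minimizer [f] along [g], by the multiple that decreases the
    energy, bounds the first-order term: [f] solves the variational equation up to
    an error proportional to ||A g||. *)
Let energy_min (m d : R) f g : 0 <= d ->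
  (forall h, L h -> m <= energy h) -> L f -> energy f <= m + d ^+ 2 -> L g ->
  cabs (ip (A f) (A g) - phi g) <= d * hnorm ip (A g).
Proof.
move=> d0 hm Lf hf Lg.
set c := ip (A f) (A g) - phi g.
rewrite -(@ler_pXn2r _ 2) ?nnegrE ?cabs_ge0 ?mulr_ge0 ?hnorm_ge0 //.
rewrite exprMn; apply: quadratic_ge0 => t.
set a : C := - t%:C * c^*.
have := hm _ (L_lin a Lg Lf).
rewrite {1}/energy A_lin // phi_lin // hnorm_expand; [|exact: A_D..].
have e1 : complex.Re (a * c) = - (t * cabs c ^+ 2) by exact: Re_variation.
have e2 : cabs a ^+ 2 = t ^+ 2 * cabs c ^+ 2 by exact: cabs_variation.
have e3 : complex.Re (a * c) = complex.Re (a * ip (A f) (A g)) - complex.Re (a * phi g).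
  by rewrite mulrBr raddfB.
rewrite e2 raddfD /=; move: hf; rewrite /energy; move: e3; rewrite e1 => ? ? ?.
by lra.
Qed.

(** A minimizing sequence of the energy ||A f||^2 - 2 Re (phi f) is mapped by
    [A] to a Cauchy sequence, and its limit represents [phi]. The space [L]
    carries no norm of its own and the range of [A] need not be closed: this allows
    [A] to be an unbounded operator such as [S^* - w] on its domain. *)
Lemma riesz : exists2 u, D u & forall f, L f -> phi f = ip u (A f).
Proof.
pose E : set R := [set energy f | f in L].
have E0 : has_inf E.
  split; first by exists (energy (fun=> 0)), (fun=> 0).
  by exists (- M ^+ 2) => _ [f Lf <-]; exact: energy_lb.
pose m := inf E.
have hm h : L h -> m <= energy h.
  by move=> Lh; apply: ge_inf; [exact: E0.2 | exists h].
pose d (n : nat) : R := n.+1%:R^-1.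
have d0 n : 0 < d n by rewrite invr_gt0.
have /choice[l hl] : forall n, exists f, L f /\ energy f <= m + d n ^+ 2.
  move=> n; have [_ [f Lf <-] hf] := inf_adherent (exprn_gt0 2 (d0 n)) E0.
  by exists f; split => //; exact: ltW.
have key n g : L g -> cabs (ip (A (l n)) (A g) - phi g) <= d n * hnorm ip (A g).
  by move=> Lg; apply: (@energy_min m) => //; [exact: ltW | exact: (hl n).1 | exact: (hl n).2].
have LB f g : L f -> L g -> L (fun z => f z - g z) by move=> *; rewrite subE; exact: L_lin.
have AB f g : L f -> L g -> A (fun z => f z - g z) = fun z => A f z - A g z.
  by move=> *; rewrite subE A_lin // subE.
have cauchy n p : hnorm ip (fun z => A (l n) z - A (l p) z) <= d n + d p.
  have [Ln Lp] := ((hl n).1, (hl p).1); have Lnp := LB _ _ Ln Lp.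
  set x := hnorm ip _.
  have x0 : 0 <= x by exact: hnorm_ge0.
  (* the two approximate variational equations, tested against the difference
     of the near-minimizers, are subtracted *)
  have : x ^+ 2 <= (d n + d p) * x.
    have -> : x ^+ 2 = cabs (ip (A (l n)) (A (fun z => l n z - l p z))
                    - ip (A (l p)) (A (fun z => l n z - l p z))).
      rewrite -ipBl ?AB //; try exact: A_D; last by apply: spaceB; exact: A_D.
      rewrite ip_self -/x ?cabsR ?ger0_norm ?sqr_ge0 //.
      by apply: spaceB; exact: A_D.
    set p1 := ip _ _; set p2 := ip _ _.
    have -> : p1 - p2 = (p1 - phi (fun z => l n z - l p z)) - (p2 - phi (fun z => l n z - l p z)) by ring.
    apply: le_trans (cabsB _ _) _; rewrite mulrDl.
    by apply: lerD; apply: le_trans (key _ _ Lnp) _; rewrite AB.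
  have [->|xn] := eqVneq x 0; first by rewrite addr_ge0 // ltW.
  by rewrite expr2 ler_pM2r // lt_neqAle eq_sym xn.
have [|eps e0|u Du hu] := @hilbert_complete _ _ _ H (fun n => A (l n)).
- by move=> n; apply: A_D; exact: (hl n).1.
- have [N hN] := inv_succ_small (divr_gt0 e0 (ltr0Sn _ 1)).
  exists N => n p /hN hn /hN hp; apply: le_lt_trans (cauchy _ _) _.
  by rewrite (splitr eps); exact: ltrD.
exists u => // f Lf; apply/eqP; rewrite -subr_eq0; apply/eqP.
apply: (@cabs_small_eq0 _ _ (2 * hnorm ip (A f))) => eps e0.
have [N hN] := inv_succ_small e0.
have [N' _ hN'] := cvgr_lt _ hu _ e0.
have {hN} hd := hN (maxn N N') (leq_maxl _ _).
have {hN'} hh := hN' (maxn N N') (leq_maxr _ _).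
move: (maxn N N') hd hh => {N N'} n hd hh.
have Dn : D (A (l n)) by apply: A_D; exact: (hl n).1.
have -> : phi f - ip u (A f) =
   ip (fun z => A (l n) z - u z) (A f) - (ip (A (l n)) (A f) - phi f).
  by rewrite ipBl //; [ring | exact: A_D].
apply: le_trans (cabsB _ _) _; rewrite mulrA mulr2n (mulrDr eps) mulr1 mulrDl.
apply: lerD; last by apply: le_trans (key n f Lf) _; rewrite ler_wpM2r ?hnorm_ge0 // ltW.
apply: le_trans (cauchy_schwarz _ _) _; [exact: spaceB | exact: A_D|].
by rewrite ler_wpM2r ?hnorm_ge0 // ltW.
Qed.

End Riesz.
End HilbertSpace.

(** * The multiplication operator, its adjoint and the graph norm *)

Section Multiplication.
Context {R : realType} {B : set (R[i] -> R[i])}.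
Context {ip : (R[i] -> R[i]) -> (R[i] -> R[i]) -> R[i]}.
Context {k : R[i] -> R[i] -> R[i]}.
Hypothesis H : is_hilbert B ip.
Hypothesis hk : reproducing_kernel B ip k.
Hypothesis hS : densely_defined B ip.
Local Notation C := R[i].
Local Notation Sstar := (Sstar B ip).
Local Notation domSstar := (domSstar B ip).
Local Notation adjoint_val := (adjoint_val B ip).
Local Notation plus_inner := (plus_inner B ip).
Local Notation plus_norm := (plus_norm B ip).
Implicit Types (f g h u : C -> C) (a w z : C).

Lemma kernel_in w : B (k^~ w).
Proof. exact: (hk w).1. Qed.

Lemma kernel_eval f w : B f -> ip (k^~ w) f = f w.
Proof. by move=> Bf; rewrite -(hk w).2. Qed.

Lemma kernel_evalr f w : B f -> ip f (k^~ w) = (f w)^*.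
Proof. by move=> Bf; rewrite (hilbert_ip_conj H (kernel_in w) Bf) kernel_eval. Qed.

Lemma eval_bound f w : B f -> cabs (f w) <= hnorm ip f * hnorm ip (k^~ w).
Proof.
by move=> Bf; rewrite -(kernel_eval w Bf) mulrC (cauchy_schwarz H) //; exact: kernel_in.
Qed.

(** The density of the domain of [S] is used through this lemma, which makes the
    value of [S^*] unique. *)
Lemma dense_orthogonal f :
  B f -> (forall u, domS B u -> ip f u = 0) -> f = fun=> 0.
Proof.
move=> Bf f0; apply: (hnorm0_eq0 H) => //.
have /complexI/eqP : (hnorm ip f ^+ 2)%:C = 0.
  apply: (@cabs_small_eq0 _ _ (hnorm ip f)) => eps /(hS Bf)[u Su fu].
  have -> : (hnorm ip f ^+ 2)%:C = ip f (fun z => f z - u z).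
    by rewrite (ipBr H) ?(f0 u) ?subr0 ?(ip_self H) //; exact: Su.1.
  apply: le_trans (cauchy_schwarz H Bf (spaceB H Bf Su.1)) _.
  by rewrite mulrC ler_wpM2r ?hnorm_ge0 // ltW.
by rewrite sqrf_eq0 => /eqP.
Qed.

Lemma mulz_lin a f g :
  mulz (fun z => a * f z + g z) = fun z => a * mulz f z + mulz g z.
Proof. by apply/funext => z; rewrite /mulz; ring. Qed.

Lemma domS_lin a f g : domS B f -> domS B g -> domS B (fun z => a * f z + g z).
Proof.
by move=> [? ?] [? ?]; split; rewrite ?mulz_lin; exact: (hilbert_lin H).
Qed.

Lemma adjoint_unique f g h : adjoint_val f g -> adjoint_val f h -> g = h.
Proof.
move=> [Bg fg] [Bh fh].
have gh0 : (fun z => g z - h z) = fun=> 0.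
  apply: dense_orthogonal; first exact: (spaceB H).
  move=> u Su; rewrite (ipBl H) ?Su.1 -?fg -?fh ?subrr //; exact: Su.1.
by apply/funext => z; apply/eqP; rewrite -subr_eq0; apply/eqP; exact: (congr1 (@^~ z) gh0).
Qed.

Lemma SstarE f g : adjoint_val f g -> Sstar f = g.
Proof.
move=> fg; apply: (adjoint_unique _ fg).
by apply: (@xgetPex _ (fun=> 0) [set h | adjoint_val f h]); exists g.
Qed.

Lemma SstarP f : domSstar f -> adjoint_val f (Sstar f).
Proof. by move=> [_ [g fg]]; rewrite (SstarE fg). Qed.

Lemma Sstar_in f : domSstar f -> B (Sstar f).
Proof. by move=> /SstarP[]. Qed.

Lemma Sstar_adj f u : domSstar f -> domS B u -> ip (mulz u) f = ip u (Sstar f).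
Proof.
move=> Sf Su; have [Bsf h] := SstarP Sf.
rewrite (hilbert_ip_conj H Sf.1 Su.2) h //.
by rewrite -(hilbert_ip_conj H) //; exact: Su.1.
Qed.

Lemma adjoint_lin a f g f' g' : B f -> B g ->
  adjoint_val f f' -> adjoint_val g g' ->
  adjoint_val (fun z => a * f z + g z) (fun z => a * f' z + g' z).
Proof.
move=> Bf Bg [Bf' hf] [Bg' hg]; split; first exact: (hilbert_lin H).
move=> u Su; have [Bu Bzu] := Su.
by rewrite !(ip_linl H) // hf // hg.
Qed.

Lemma domSstar_lin a f g :
  domSstar f -> domSstar g -> domSstar (fun z => a * f z + g z).
Proof.
move=> Sf Sg; split; first exact: (hilbert_lin H _ Sf.1 Sg.1).
by exists (fun z => a * Sstar f z + Sstar g z); exact: (adjoint_lin _ Sf.1 Sg.1 (SstarP Sf) (SstarP Sg)).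
Qed.

Lemma Sstar_lin a f g : domSstar f -> domSstar g ->
  Sstar (fun z => a * f z + g z) = fun z => a * Sstar f z + Sstar g z.
Proof.
move=> Sf Sg; apply: SstarE.
exact: (adjoint_lin _ Sf.1 Sg.1 (SstarP Sf) (SstarP Sg)).
Qed.

Lemma adjoint0 : adjoint_val (fun=> 0) (fun=> 0).
Proof.
split; first exact: (hilbert_zero H).
move=> u [Bu Bzu].
rewrite (hilbert_ip_conj H Bzu (hilbert_zero H)) (ip0r H) //.
by rewrite (hilbert_ip_conj H Bu (hilbert_zero H)) (ip0r H).
Qed.

Lemma domSstar0 : domSstar (fun=> 0).
Proof. by split; [exact: (hilbert_zero H) | exists (fun=> 0); exact: adjoint0]. Qed.

Lemma domSstarB f g : domSstar f -> domSstar g -> domSstar (fun z => f z - g z).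
Proof. by move=> Sf Sg; rewrite subE; exact: domSstar_lin. Qed.

Lemma SstarB f g : domSstar f -> domSstar g ->
  Sstar (fun z => f z - g z) = fun z => Sstar f z - Sstar g z.
Proof. by move=> Sf Sg; rewrite subE Sstar_lin // subE. Qed.

Lemma adjoint_kernel w : adjoint_val (k^~ w) (fun z => w^* * k z w).
Proof.
split; first exact: (spaceZ H _ (kernel_in w)).
move=> u [Bu Bzu]; rewrite kernel_eval // (ipZl H) ?kernel_eval ?conjcK //.
exact: kernel_in.
Qed.

Lemma domSstar_kernel w : domSstar (k^~ w).
Proof. by split; [exact: kernel_in | eexists; exact: adjoint_kernel]. Qed.

Lemma Sstar_kernel w : Sstar (k^~ w) = fun z => w^* * k z w.
Proof. exact: (SstarE (adjoint_kernel w)). Qed.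

Lemma plus_innerE f : domSstar f ->
  plus_inner f f = (hnorm ip (Sstar f) ^+ 2 + hnorm ip f ^+ 2)%:C.
Proof.
move=> Sf; rewrite /plus_inner !(ip_self H) ?realcD //; [exact: Sf.1|exact: Sstar_in].
Qed.

Lemma plus_normE f : domSstar f ->
  plus_norm f ^+ 2 = hnorm ip (Sstar f) ^+ 2 + hnorm ip f ^+ 2.
Proof.
by move=> Sf; rewrite /plus_norm plus_innerE //= sqr_sqrtr // addr_ge0 ?sqr_ge0.
Qed.

Lemma plus_norm_ge0 f : 0 <= plus_norm f.
Proof. exact: sqrtr_ge0. Qed.

Lemma hnorm_le_plus f : domSstar f -> hnorm ip f <= plus_norm f.
Proof.
move=> Sf; rewrite -(@ler_pXn2r _ 2) ?nnegrE ?hnorm_ge0 ?plus_norm_ge0 //.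
by rewrite plus_normE // lerDr sqr_ge0.
Qed.

Lemma hnorm_Sstar_le_plus f : domSstar f -> hnorm ip (Sstar f) <= plus_norm f.
Proof.
move=> Sf; rewrite -(@ler_pXn2r _ 2) ?nnegrE ?hnorm_ge0 ?plus_norm_ge0 //.
by rewrite plus_normE // lerDl sqr_ge0.
Qed.

Lemma plus_norm_le f : domSstar f ->
  plus_norm f <= hnorm ip (Sstar f) + hnorm ip f.
Proof.
move=> Sf; rewrite -(@ler_pXn2r _ 2) ?nnegrE ?addr_ge0 ?hnorm_ge0 ?plus_norm_ge0 //.
rewrite plus_normE // sqrrD addrAC lerDl mulrn_wge0 // mulr_ge0 ?hnorm_ge0 //.
Qed.

Lemma adjoint_closed (f_ : nat -> C -> C) f g : (forall n, domSstar (f_ n)) ->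
  B f -> B g ->
  (fun n => hnorm ip (fun z => f_ n z - f z)) @ \oo --> (0 : R) ->
  (fun n => hnorm ip (fun z => Sstar (f_ n) z - g z)) @ \oo --> (0 : R) ->
  adjoint_val f g.
Proof.
move=> Sf Bf Bg ff gg; split => // u [Bu Bzu].
apply/eqP; rewrite -subr_eq0; apply/eqP.
apply: (@cabs_small_eq0 _ _ (hnorm ip u + hnorm ip (mulz u))) => eps e0.
have [N _ hN] := cvgr_lt _ ff _ e0.
have [N' _ hN'] := cvgr_lt _ gg _ e0.
have {hN} hd := hN (maxn N N') (leq_maxl _ _).
have {hN'} hh := hN' (maxn N N') (leq_maxr _ _).
move: (maxn N N') hd hh => {N N'} n hd hh.
have Sn := Sf n; have [Bn' hn] := SstarP Sn; have Bn := Sn.1.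
have -> : ip f (mulz u) - ip g u =
  ip (fun z => Sstar (f_ n) z - g z) u - ip (fun z => f_ n z - f z) (mulz u).
  rewrite !(ipBl H) // hn //; ring.
apply: le_trans (cabsB _ _) _; rewrite mulrDr; apply: lerD.
  apply: le_trans (cauchy_schwarz H (spaceB H Bn' Bg) Bu) _.
  by rewrite ler_wpM2r ?hnorm_ge0 // ltW.
apply: le_trans (cauchy_schwarz H (spaceB H Bn Bf) Bzu) _.
by rewrite ler_wpM2r ?hnorm_ge0 // ltW.
Qed.

(** Completeness of the graph norm is the closedness of [S^*]: limits of the
    [f_ n] and of the [S^* (f_ n)] exist in [B], and form a point of the graph. *)
Lemma hilbert_plus : is_hilbert domSstar plus_inner.
Proof.
split.
- exact: domSstar0.
- exact: domSstar_lin.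
- move=> f a g h Sf Sg Sh; have [Bf Bg Bh] := And3 Sf.1 Sg.1 Sh.1.
  rewrite /plus_inner Sstar_lin // !(hilbert_ip_lin H) //; try exact: Sstar_in.
  ring.
- move=> f g Sf Sg; rewrite /plus_inner rmorphD /=.
  by rewrite -!(hilbert_ip_conj H) //; [exact: Sf.1|exact: Sg.1|exact: Sstar_in..].
- move=> f Sf f0; rewrite plus_innerE // realcD.
  apply: ltr_wpDl; first by rewrite ler0c sqr_ge0.
  by rewrite -(ip_self H Sf.1); exact: (hilbert_ip_pos H Sf.1).
- move=> f_ Sf cf.
  have SB m n : domSstar (fun z => f_ m z - f_ n z) by exact: domSstarB.
  have [|eps e0|u Bu hu] := @hilbert_complete _ _ _ H f_.
  + by move=> n; exact: (Sf n).1.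
  + have [N hN] := cf _ e0; exists N => m n Nm Nn.
    exact: le_lt_trans (hnorm_le_plus (SB m n)) (hN m n Nm Nn).
  have [|eps e0|v Bv hv] := @hilbert_complete _ _ _ H (fun n => Sstar (f_ n)).
  + by move=> n; exact: Sstar_in.
  + have [N hN] := cf _ e0; exists N => m n Nm Nn.
    apply: le_lt_trans (hN m n Nm Nn).
    by rewrite -(SstarB (Sf m) (Sf n)); exact: hnorm_Sstar_le_plus.
  have uv := adjoint_closed Sf Bu Bv hu hv.
  have Su : domSstar u by split => //; exists v.
  exists u => //; apply: (@squeeze_cvgr _ _ _ _ (fun=> 0)
    (fun n => hnorm ip (fun z => Sstar (f_ n) z - v z) + hnorm ip (fun z => f_ n z - u z))).
  + apply: nearW => n; rewrite plus_norm_ge0 /=.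
    by rewrite -(SstarE uv) -(SstarB (Sf n) Su); exact: (plus_norm_le (domSstarB (Sf n) Su)).
  + exact: cvg_cst.
  + by rewrite -[X in _ --> X](addr0 (0 : R)); exact: cvgD.
Qed.

Lemma plus_norm_gt0 f : domSstar f -> f <> (fun=> 0) -> 0 < plus_norm f.
Proof.
move=> Sf f0; rewrite lt_neqAle plus_norm_ge0 andbT eq_sym; apply/eqP.
by move=> /(hnorm0_eq0 hilbert_plus Sf).
Qed.

Lemma ip_minus_bound f : B f -> forall g, domSstar g ->
  cabs (ip f g) <= minus_norm B ip f * plus_norm g.
Proof.
move=> Bf g Sg; have [->|g0] := pselect (g = fun=> 0).
  by rewrite (ip0r H) // cabs0 /plus_norm (ip0r hilbert_plus domSstar0) sqrtr0 mulr0.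
have p0 := plus_norm_gt0 Sg g0.
rewrite -ler_pdivrMr //; apply: ub_le_sup; last by exists g.
(* the supremum is finite: [plus_norm] dominates the norm of [B] *)
exists (hnorm ip f) => _ [h [Sh h0 ->]].
have q0 := plus_norm_gt0 Sh h0.
rewrite ler_pdivrMr //; apply: le_trans (cauchy_schwarz H Bf Sh.1) _.
by rewrite ler_wpM2l ?hnorm_ge0 // hnorm_le_plus.
Qed.

Lemma minus_norm_le f (M : R) : 0 <= M -> B f ->
  (forall g, domSstar g -> cabs (ip f g) <= M * plus_norm g) ->
  minus_norm B ip f <= M.
Proof.
move=> M0 Bf hM; rewrite /minus_norm; set E := [set _ | _].
have [[x Ex]|E0] := pselect (E !=set0); last first.
  (* the supremum over the empty set is 0 *)
  have -> : E = set0 by apply/seteqP; split => [x Ex|//]; apply: E0; exists x.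
  by rewrite sup0.
apply: ge_sup; first by exists x.
move=> _ [h [Sh h0 ->]].
have q0 := plus_norm_gt0 Sh h0.
by rewrite ler_pdivrMr // hM.
Qed.

End Multiplication.

(** * Entire functions near a point *)

Section LocalBehaviour.
Context {R : realType}.
Local Notation C := R[i].
Implicit Types (f g h e : C -> C) (a w z v : C).

Lemma ex_nonzero_point f : f <> (fun=> 0) -> exists v, f v != 0.
Proof.
move=> f0; apply: contrapT => h; apply: f0; apply/funext => v.
by apply/eqP; apply: contrapT => /negP fv; apply: h; exists v.
Qed.

(** The form in which differentiability enters the continuity and division
    arguments below. *)
Lemma locally_lipschitz f z : holomorphic_at f z ->
  exists K d : R, [/\ 0 <= K, 0 < d & forall w, cabs (w - z) < d ->
    cabs (f w - f z) <= K * cabs (w - z)].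
Proof.
move=> /cvg_ex[l] /cvgrPdist_lt /(_ 1 ltr01).
rewrite near_withinE => /nbhs_ballP[r /= r0 hr].
have rE := gt0_real_complex r0.
exists (cabs l + 1), (complex.Re r); split.
- by rewrite addr_ge0 ?cabs_ge0.
- by move: r0; rewrite rE -[0]/(0%:C) ltcR.
move=> w wz; have [->|wnz] := eqVneq w z; first by rewrite !subrr cabs0 mulr0.
have wz0 : w - z != 0 by rewrite subr_eq0.
have := hr (w - z); rewrite -ball_normE /= sub0r normrN.
rewrite {1}rE -cabsE ltcR wz => /(_ isT wz0).
rewrite /GRing.scale /= mulr1 subrK -cabsE -[1]/(1%:C) ltcR => h.
have -> : f w - f z = (w - z) * (l - (l - (w - z)^-1 * (f w - f z))).
  by field.
rewrite cabsM mulrC ler_wpM2r ?cabs_ge0 //.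
by apply: le_trans (cabsB _ _) _; rewrite lerD2l ltW.
Qed.

Lemma locally_away_from0 f z : holomorphic_at f z -> f z != 0 ->
  exists2 d : R, 0 < d & forall w, cabs (w - z) < d -> cabs (f z) / 2 <= cabs (f w).
Proof.
move=> /locally_lipschitz[K [d [K0 d0 hK]]] fz.
have c0 := cabs_gt0 fz.
(* [K + 1] rather than [K], which may be 0 *)
exists (Num.min d (cabs (f z) / 2 / (K + 1))).
  by rewrite lt_min d0 !divr_gt0 // ltr_wpDl.
move=> w; rewrite lt_min => /andP[/hK h].
rewrite ltr_pdivlMr ?ltr_wpDl // mulrDr mulr1 => h2.
have h3 : cabs (f z) <= cabs (f w) + cabs (f w - f z).
  by rewrite -{1}(subrK (f w) (f z)) addrC (cabsC (f w)) cabsD.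
have h4 := cabs_ge0 (w - z).
lra.
Qed.

Lemma ex_nonzero_neq f v : entire f -> f v != 0 ->
  exists2 w, w != v & f w != 0.
Proof.
move=> fe fv; have [d d0 hd] := locally_away_from0 (fe v) fv.
have d2 : (d / 2)%:C != 0 :> C by rewrite gt_eqF // -[0]/(0%:C) ltcR divr_gt0.
exists (v + (d / 2)%:C); first by rewrite -subr_eq0 addrAC subrr add0r.
apply: contraTneq (divr_gt0 (cabs_gt0 fv) (ltr0Sn R 1)) => fw0.
rewrite -leNgt; apply: le_trans (hd (v + (d / 2)%:C) _) _; last by rewrite fw0 cabs0.
rewrite addrAC subrr add0r cabsR ger0_norm ?divr_ge0 ?ltW //.
by rewrite ltr_pdivrMr // ltr_pMr // ltr1n.
Qed.

Lemma ex_nonzero_nonreal f v : entire f -> f v != 0 ->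
  exists2 w, complex.Im w != 0 & f w != 0.
Proof.
move=> fe fv; have [v0|v0] := eqVneq (complex.Im v) 0; last by exists v.
have [d d0 hd] := locally_away_from0 (fe v) fv.
have d2 : 0 < d / 2 by rewrite divr_gt0.
exists (v + 0 +i* (d / 2)); first by rewrite raddfD /= v0 add0r gt_eqF.
apply: contraTneq (divr_gt0 (cabs_gt0 fv) (ltr0Sn R 1)) => fw0.
rewrite -leNgt; apply: le_trans (hd (v + 0 +i* (d / 2)) _) _; last by rewrite fw0 cabs0.
rewrite addrAC subrr add0r /cabs normc_def /= expr0n /= add0r sqrtr_sqr ger0_norm ?ltW //.
by rewrite ltr_pdivrMr // ltr_pMr // ltr1n.
Qed.

Lemma continuous_cabs_real f : entire f -> continuous (fun x : R => cabs (f x%:C)).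
Proof.
move=> fe x; apply/cvgrPdist_le => eps e0.
have [K [d [K0 d0 hK]]] := locally_lipschitz (fe x%:C).
have K1 : 0 < K + 1 by rewrite ltr_wpDl.
near=> y.
have yx : cabs (y%:C - x%:C) = `|x - y| by rewrite -rmorphB cabsR distrC.
have yd : `|x - y| < d.
  near: y; apply/nbhs_ballP; exists d => //= y; rewrite /ball /=.
have ye : `|x - y| <= eps / (K + 1).
  near: y; apply/nbhs_ballP; exists (eps / (K + 1)); rewrite /= ?divr_gt0 // => y; exact: ltW.
have := hK y%:C; rewrite yx => /(_ yd) h.
have h2 : K * `|x - y| <= eps.
  rewrite ler_pdivlMr // in ye; apply: le_trans ye.
  by rewrite mulrDr mulr1 mulrC lerDl.
apply: le_trans h2; apply: le_trans h.
rewrite ler_norml; apply/andP; split.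
  rewrite lerNl opprB lerBlDr; apply: le_trans (cabsD _ _).
  by rewrite subrK.
rewrite lerBlDr cabsC; apply: le_trans (cabsD _ _).
by rewrite subrK.
Unshelve. all: by end_near. Qed.

End LocalBehaviour.

(** * The norm as a weighted integral *)

Section WeightedIntegral.
Context {R : realType} {B : set (R[i] -> R[i])}.
Context {ip : (R[i] -> R[i]) -> (R[i] -> R[i]) -> R[i]} {e : R[i] -> R[i]}.
Hypothesis H : is_hilbert B ip.
Hypothesis Bentire : forall f, B f -> entire f.
Hypothesis eentire : entire e.
Hypothesis he0 : no_real_zeros e.
Hypothesis hipe : forall f g, B f -> B g -> ip f g = dB_inner e f g.
Local Notation C := R[i].
Local Notation mu := lebesgue_measure.
Implicit Types (f g h u : C -> C).

(** The density with respect to Lebesgue measure of the measure whose total mass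
    is the squared norm of [f]. *)
Definition density f (x : R) : R := cabs (f x%:C) ^+ 2 / cabs (e x%:C) ^+ 2.

Lemma density_ge0 f x : 0 <= density f x.
Proof. by rewrite divr_ge0 // sqr_ge0. Qed.

Lemma measurable_density f : entire f -> measurable_fun setT (density f).
Proof.
move=> fe; apply: continuous_measurable_fun => x.
apply: cvgM; first by apply: cvgM; exact: continuous_cabs_real.
apply: cvgV; first by rewrite expf_neq0 // gt_eqF // cabs_gt0.
by apply: cvgM; exact: continuous_cabs_real.
Qed.

(** The real integral defining the inner product is the finite part of an
    extended one, and would be zero if the latter were infinite; positivity of
    the inner product excludes this. *)
Lemma hnorm_integral f : B f ->
  (\int[mu]_x (density f x)%:E = (hnorm ip f ^+ 2)%:E)%E.
Proof.
move=> Bf; have [f0|f0] := pselect (f = fun=> 0).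
  rewrite f0 (hnorm0 H) expr0n /=; apply: integral0_eq => x _.
  by rewrite /density cabs0 expr0n /= mul0r.
have fn : hnorm ip f ^+ 2 = fine (\int[mu]_x (density f x)%:E).
  apply: complexI; rewrite -(ip_self H Bf) (hipe Bf Bf) /dB_inner.
  have hx (x : R) : (f x%:C)^* * f x%:C / `|e x%:C| ^+ 2 = (density f x)%:C.
    by rewrite mulJc -cabsE /density realcM fmorphV; congr (_ / _); rewrite [RHS]realcM.
  rewrite /cintegral (_ : (fun x : R => complex.Im _) = fun=> 0); last first.
    by apply/funext => x; rewrite -[Num.conj _]/(conjc _) hx.
  rewrite (_ : (fun x : R => complex.Re _) = density f); last first.
    by apply/funext => x; rewrite -[Num.conj _]/(conjc _) hx.
  rewrite /Rintegral integral0 //.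
have : 0 < fine (\int[mu]_x (density f x)%:E).
  by rewrite -fn -ltcR -(ip_self H Bf); exact: (hilbert_ip_pos H Bf).
by rewrite fn; case: (\int[mu]_x _)%E => //=; rewrite ltxx.
Qed.

Lemma hnorm_le_split f g (w c d K : R) : B f -> B g -> 0 < d -> 0 <= c -> 0 <= K ->
  (forall x : R, `|x - w| < d -> density g x <= c) ->
  (forall x : R, d <= `|x - w| -> density g x <= K * density f x) ->
  hnorm ip g ^+ 2 <= c * (2 * d) + K * hnorm ip f ^+ 2.
Proof.
move=> Bf Bg d0 c0 K0 hin hout.
pose A : set R := `]w - d, w + d[%classic.
have mA : measurable A by exact: measurable_itv.
have m1 : measurable_fun setT (fun x => (c * \1_A x)%:E : \bar R).
  by apply/measurable_EFinP; apply: measurable_funM => //; exact: measurable_indic.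
have m2 : measurable_fun setT (fun x => (K * density f x)%:E : \bar R).
  apply/measurable_EFinP; apply: measurable_funM => //; apply: measurable_density.
  exact: Bentire.
rewrite -lee_fin -(hnorm_integral Bg) EFinD.
have -> : ((c * (2 * d))%:E = \int[mu]_x (c * \1_A x)%:E)%E.
  under eq_integral do rewrite EFinM.
  rewrite ge0_integralZl //; last 1 first.
  - by apply/measurable_EFinP; exact: measurable_indic.
  rewrite integral_indic // setIT.
  have -> : (lebesgue_measure : {measure set _ -> \bar R}) A = (2 * d)%:E.
    apply: etrans (lebesgue_measure_itv `]w - d, w + d[) _.
    rewrite /= lte_fin ltrD2l gtrN // -EFinB; congr (_%:E); ring.
  by rewrite -EFinM.
have -> : ((K * hnorm ip f ^+ 2)%:E = \int[mu]_x (K * density f x)%:E)%E.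
  under eq_integral do rewrite EFinM.
  rewrite ge0_integralZl ?hnorm_integral //.
  - by apply/measurable_EFinP; apply: measurable_density; exact: Bentire.
  - by move=> x _; rewrite lee_fin density_ge0.
rewrite -ge0_integralD //; first last.
- by move=> x _; rewrite lee_fin mulr_ge0 // density_ge0.
- by move=> x _; rewrite lee_fin mulr_ge0.
apply: ge0_le_integral => //.
- by move=> x _; rewrite lee_fin density_ge0.
- by apply/measurable_EFinP; apply: measurable_density; exact: Bentire.
- exact: emeasurable_funD.
move=> x _; rewrite -EFinD lee_fin.
have [xw|xw] := ltP `|x - w| d.
  apply: le_trans (hin x xw) _; rewrite indicE mem_set; last first.
    by rewrite /A /= in_itv /= -ltr_distl.
  by rewrite mulr1 lerDl mulr_ge0 // density_ge0.
by apply: le_trans (hout x xw) _; rewrite lerDr mulr_ge0.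
Qed.

End WeightedIntegral.

(** * Division by a linear factor and associated functions *)

Section Division.
Context {R : realType} {B : set (R[i] -> R[i])}.
Context {ip : (R[i] -> R[i]) -> (R[i] -> R[i]) -> R[i]} {e : R[i] -> R[i]}.
Context {k : R[i] -> R[i] -> R[i]}.
Hypothesis hdB : is_dB_space B ip.
Hypothesis hB0 : exists2 f, B f & f <> (fun=> 0).
Hypothesis eentire : entire e.
Hypothesis he0 : no_real_zeros e.
Hypothesis hipe : forall f g, B f -> B g -> ip f g = dB_inner e f g.
Hypothesis hk : reproducing_kernel B ip k.
Hypothesis hS : densely_defined B ip.
Local Notation C := R[i].
Local Notation Sstar := (Sstar B ip).
Local Notation domSstar := (domSstar B ip).
Implicit Types (f g h u q s : C -> C) (a w z v : C).

Let H : is_hilbert B ip := dB_hilbert hdB.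

Let Bentire f : B f -> entire f.
Proof. exact: (dB_entire hdB). Qed.

Lemma divide_nonreal q v : B q -> complex.Im v != 0 -> q v = 0 ->
  exists2 g, B g & forall z, (z - v) * g z = q z.
Proof.
move=> Bq v0 qv; have [g [Bg hg _]] := dB_factor hdB Bq v0 qv.
have vv : v - v^* != 0.
  by apply: contra_neq v0 => /(congr1 (@complex.Im R)); case: (v) => x y /=; lra.
exists (fun z => (v - v^*)^-1 * (g z - q z)); first exact: (spaceZ H _ (spaceB H Bg Bq)).
move=> z; rewrite mulrCA mulrBr hg -mulrBl.
by rewrite (_ : z - v^* - (z - v) = v - v^*) ?mulKf //; ring.
Qed.

Lemma mulz_symmetric f g : domS B f -> domS B g -> ip f (mulz g) = ip (mulz f) g.
Proof.
move=> [Bf Bzf] [Bg Bzg]; rewrite !hipe // /dB_inner /cintegral.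
have E (x : R) : Num.conj (f x%:C) * mulz g x%:C / `|e x%:C| ^+ 2
             = Num.conj (mulz f x%:C) * g x%:C / `|e x%:C| ^+ 2.
  rewrite /mulz rmorphM /= (_ : Num.conj x%:C = x%:C); last exact: conjc_real.
  by rewrite mulrCA !mulrA.
by congr (_ +i* _); apply: eq_Rintegral => x _; rewrite E.
Qed.

(** If every function of [B] vanished at a non-real [w], hence also at its
    conjugate, both [S - w] and [S - conj w] would be onto, so that [S] would be
    self-adjoint; but then the kernels, being eigenvectors of [S], are zero. *)
Lemma ex_nonzero_at w : complex.Im w != 0 -> exists2 f, B f & f w != 0.
Proof.
move=> w0; apply: contrapT => hn.
have fw0 f : B f -> f w = 0.
  by move=> Bf; apply/eqP; apply: contrapT => /negP fw; apply: hn; exists f.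
have fwJ0 f : B f -> f w^* = 0.
  move=> Bf; have := fw0 _ (dB_sharp hdB Bf).1; rewrite /sharp => h.
  by rewrite -[f _]conjcK [X in X^*]h conjc0.
have [f0 Bf0 nf0] := hB0.
have [v /eqP fv] := ex_nonzero_point nf0.
have Bk := kernel_in hk v.
have w0' : complex.Im w^* != 0 by case: (w) w0 => x y /=; rewrite oppr_eq0.
have [x Bx hx] := divide_nonreal (spaceZ H (v^* - w) Bk) w0 (fw0 _ (spaceZ H _ Bk)).
have zxE : mulz x = fun z => w * x z + (v^* - w) * k z v.
  by apply/funext => z; rewrite -hx /mulz; ring.
have Sx : domS B x.
  by split => //; rewrite zxE; apply: (hilbert_lin H) => //; exact: (spaceZ H).
pose d := fun z => k z v - x z.
have Bd : B d by exact: (spaceB H).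
have [y By hy] := divide_nonreal Bd w0' (fwJ0 _ Bd).
have zyE : mulz y = fun z => w^* * y z + d z.
  by apply/funext => z; rewrite -hy /mulz; ring.
have Sy : domS B y by split => //; rewrite zyE; exact: (hilbert_lin H).
(* [d] is orthogonal to the range of [S - conj w], to which it belongs *)
have d0 : ip d d = 0.
  rewrite /d (ipBl H) // -/d (kernel_eval hk) // -hy.
  have := mulz_symmetric Sx Sy.
  rewrite zyE zxE (hilbert_ip_lin H) // (ip_linl H) //; last exact: (spaceZ H).
  rewrite (ipZl H) // (kernel_eval hk) // rmorphB /= conjcK => /addrI ->.
  by rewrite subrr.
have kx : d = fun=> 0.
  apply: (hnorm0_eq0 H) => //; apply/eqP; rewrite -sqrf_eq0; apply/eqP.
  by apply: complexI; rewrite -(ip_self H) // d0.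
have kv z : z != v^* -> k z v = 0.
  move=> zv; have := congr1 (@^~ z) kx; rewrite /d /= => /eqP; rewrite subr_eq0 => /eqP kz.
  have := hx z; rewrite -kz => /eqP; rewrite -subr_eq0 -mulrBl mulf_eq0.
  rewrite (_ : z - w - (v^* - w) = z - v^*); last by ring.
  by rewrite subr_eq0 (negbTE zv) => /eqP.
have k0 : k^~ v = fun=> 0.
  apply/funext => z; have [->|] := eqVneq z v^*; last exact: kv.
  apply/eqP; apply: contrapT => /negP kz.
  have [z' zv] := ex_nonzero_neq (Bentire Bk) kz.
  by rewrite kv ?eqxx.
apply: fv; rewrite -(kernel_eval hk v Bf0) k0.
by rewrite (hilbert_ip_conj H Bf0 (hilbert_zero H)) (ip0r H) ?conjc0.
Qed.

(** The quotients of [q] by [z - (w + i t)], corrected by a multiple of [s] to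
    remove the pole, stay bounded in [B] as [w + i t] tends to the real zero [w]
    of [q]. Near [w] this holds because [q] is Lipschitz at the single point [w]
    and both |x - w| and [t] are at most |x - (w + i t)|; it is there that [e]
    must not vanish. Away from [w] the quotient is dominated by its numerator. *)
Lemma quotient_bounded q s (w : R) : B q -> q w%:C = 0 -> B s -> s w%:C != 0 ->
  exists N K d : R, [/\ 0 <= N, 0 <= K, 0 < d & forall t : R, 0 < t -> t < d ->
    exists g c, [/\ B g, forall z, (z - (w +i* t)) * g z = q z - c * s z,
      cabs c <= K * t & hnorm ip g <= N]].
Proof.
move=> Bq qw Bs sw.
have [Kq [dq [Kq0 dq0 hq]]] := locally_lipschitz (@Bentire _ Bq w%:C).
have [Ks [ds [Ks0 ds0 hs]]] := locally_lipschitz (@Bentire _ Bs w%:C).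
have [d1 d10 h1] := locally_away_from0 (@Bentire _ Bs w%:C) sw.
have [d2 d20 h2] := locally_away_from0 (@eentire w%:C) (he0 w).
pose d := Num.min (Num.min dq ds) (Num.min d1 d2).
have d0 : 0 < d by rewrite !lt_min dq0 ds0 d10 d20.
have hd (x : R) : x < d -> [/\ x < dq, x < ds, x < d1 & x < d2].
  by rewrite !lt_min => /andP[/andP[-> ->] /andP[-> ->]].
set sg := cabs (s w%:C) / 2 in h1; have sg0 : 0 < sg by rewrite divr_gt0 ?cabs_gt0.
set eta := cabs (e w%:C) / 2 in h2; have eta0 : 0 < eta by rewrite divr_gt0 ?cabs_gt0 ?he0.
pose Sg := cabs (s w%:C) + Ks * d.
have Sg0 : 0 <= Sg by rewrite addr_ge0 ?cabs_ge0 ?mulr_ge0 // ltW.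
pose K := Kq / sg; have K0 : 0 <= K by rewrite divr_ge0 // ltW.
pose C1 := Kq + K * Sg; have C10 : 0 <= C1 by apply: addr_ge0 => //; exact: mulr_ge0.
pose Q := hnorm ip q + K * d * hnorm ip s.
have Kd0 : 0 <= K * d by apply: mulr_ge0 => //; exact: ltW.
have Q0 : 0 <= Q by apply: addr_ge0; [exact: hnorm_ge0 | apply: mulr_ge0 => //; exact: hnorm_ge0].
(* contribution of the interval |x - w| < d, of length [2 * d], and of its
   complement *)
pose N2 := C1 ^+ 2 / eta ^+ 2 * (2 * d) + d ^- 2 * Q ^+ 2.
exists (Num.sqrt N2), K, d; split => //.
move=> t t0 td; set v := w +i* t.
have vw : cabs (v - w%:C) = t.
  rewrite /v /cabs normc_def /= subrr expr0n /= subr0 add0r sqrtr_sqr.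
  by rewrite ger0_norm // ltW.
have [tq ts t1 t2] := hd t td.
have sv : sg <= cabs (s v) by apply: h1; rewrite vw.
have sv0 : s v != 0.
  by apply: contraTneq sv => ->; rewrite cabs0 -ltNge.
(* the correction [c * s] makes the numerator vanish at [v] *)
pose c := q v / s v.
have cK : cabs c <= K * t.
  have qv : cabs (q v) <= Kq * t by have := hq v; rewrite vw qw subr0; exact.
  rewrite /c /K cabsM cabsV mulrAC ler_pM ?invr_ge0 ?cabs_ge0 //.
  by rewrite lef_pV2 ?posrE // (lt_le_trans sg0).
pose qv := fun z => q z - c * s z.
have Bqv : B qv by apply: (spaceB H) => //; exact: (spaceZ H).
have qv0 : qv v = 0 by rewrite /qv /c divfK ?subrr.
have v0 : complex.Im v != 0 by rewrite gt_eqF.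
have [g Bg hg] := divide_nonreal Bqv v0 qv0.
exists g, c; split => //.
have qvQ : hnorm ip qv <= Q.
  apply: le_trans (hnorm_sub H Bq (spaceZ H c Bs)) _.
  rewrite lerD2l (hnorm_scale H) // ler_wpM2r ?hnorm_ge0 //.
  by apply: le_trans cK _; rewrite ler_wpM2l // ltW.
have xv (x : R) : [/\ `|x - w| <= cabs (x%:C - v), t <= cabs (x%:C - v) & 0 < cabs (x%:C - v)].
  have h : t <= cabs (x%:C - v).
    by apply: le_trans (ler_Im_cabs _); rewrite /= sub0r normrN ger0_norm // ltW.
  split; [exact: le_trans (ler_Re_cabs _) | exact: h | exact: lt_le_trans h].
have gx (x : R) : cabs (g x%:C) * cabs (x%:C - v) = cabs (qv x%:C).
  by rewrite -cabsM mulrC hg.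
have N20 : hnorm ip g ^+ 2 <= N2.
  apply: le_trans (_ : _ <= C1 ^+ 2 / eta ^+ 2 * (2 * d) + d ^- 2 * hnorm ip qv ^+ 2) _; last first.
    rewrite lerD2l ler_wpM2l ?invr_ge0 ?sqr_ge0 // ler_pXn2r ?nnegrE ?hnorm_ge0 //.
  apply: (hnorm_le_split H Bentire eentire he0 hipe (w := w)) => //.
  - by rewrite divr_ge0 ?sqr_ge0.
  - by rewrite invr_ge0 sqr_ge0.
  - move=> x xw; have [xvw xvt xv0] := xv x.
    have xwc : cabs (x%:C - w%:C) = `|x - w| by rewrite -rmorphB cabsR.
    have [xq xs x1 x2] := hd _ xw.
    have gC : cabs (g x%:C) <= C1.
      rewrite -(ler_pM2r xv0) gx /qv; apply: le_trans (cabsB _ _) _.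
      rewrite mulrDl; apply: lerD.
        have := hq x%:C; rewrite xwc qw subr0 => /(_ xq) h.
        by apply: le_trans h _; rewrite ler_wpM2l.
      rewrite cabsM -mulrA [Sg * _]mulrC mulrA ler_pM ?cabs_ge0 //.
        by apply: le_trans cK _; rewrite ler_wpM2l.
      have := hs x%:C; rewrite xwc => /(_ xs) h.
      rewrite -(subrK (s w%:C) (s x%:C)) addrC; apply: le_trans (cabsD _ _) _.
      by rewrite lerD2l; apply: le_trans h _; rewrite ler_wpM2l // ltW.
    have ex : eta <= cabs (e x%:C) by apply: h2; rewrite xwc.
    rewrite /density ler_pM ?invr_ge0 ?sqr_ge0 //.
      by rewrite ler_pXn2r ?nnegrE ?cabs_ge0.
    have e0' := lt_le_trans eta0 ex.
    by rewrite lef_pV2 ?posrE ?exprn_gt0 // ler_pXn2r ?nnegrE // ltW.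
  - move=> x xw; have [xvw xvt xv0] := xv x.
    rewrite /density mulrA ler_wpM2r ?invr_ge0 ?sqr_ge0 //.
    rewrite ler_pdivlMl ?exprn_gt0 // -exprMn ler_pXn2r ?nnegrE ?mulr_ge0 ?cabs_ge0 ?(ltW d0) //.
    by rewrite -gx mulrC ler_wpM2l ?cabs_ge0 // (le_trans xw).
by rewrite -(ger0_norm (hnorm_ge0 g)) -sqrtr_sqr ler_wsqrtr.
Qed.

(** The bounded quotients above give |<q, l>| <= N ||(S^* - w) l|| on the domain
    of [S^*], and the element of [B] representing this functional is the quotient,
    as is seen by testing against kernels. The removable singularity at [w] is thus
    filled in by the Hilbert space rather than by complex analysis. *)
Lemma divide_real q s (w : R) : B q -> q w%:C = 0 -> B s -> s w%:C != 0 ->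
  exists2 g, B g & forall z, (z - w%:C) * g z = q z.
Proof.
move=> Bq qw Bs sw.
have [N [K [d [N0 K0 d0 hN]]]] := quotient_bounded Bq qw Bs sw.
pose A l := fun z => (Sstar l) z - w%:C * l z.
have BA l : domSstar l -> B (A l).
  by move=> Sl; apply: (spaceB H); [exact: Sstar_in|exact: (spaceZ H _ Sl.1)].
have bnd l : domSstar l -> cabs (ip q l) <= N * hnorm ip (A l).
  move=> Sl; have Bl := Sl.1.
  set M := hnorm ip s * hnorm ip l * K + N * hnorm ip l.
  have M0 : 0 <= M by rewrite addr_ge0 ?mulr_ge0 ?hnorm_ge0.
  apply/ler_addgt0Pr => eps eps0.
  pose t := Num.min (d / 2) (eps / (M + 1)).
  have M1 : 0 < M + 1 by rewrite ltr_wpDl.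
  have t0 : 0 < t by rewrite lt_min !divr_gt0.
  have td : t < d by rewrite gt_min ltr_pdivrMr // ltr_pMr // ltr1n.
  have tM : t * M <= eps.
    have : t <= eps / (M + 1) by rewrite ge_min lexx orbT.
    by rewrite ler_pdivlMr // => h; apply: le_trans h; rewrite ler_pM2l // lerDl.
  have [g [c [Bg hg hc gN]]] := hN t t0 td.
  set v := w +i* t in hg.
  have zgE : mulz g = fun z => v * g z + (q z - c * s z).
    by apply/funext => z; rewrite -hg /mulz; ring.
  have Bcs := spaceZ H c Bs.
  have Sg : domS B g by split => //; rewrite zgE; exact: (hilbert_lin H _ Bg (spaceB H Bq Bcs)).
  have := Sstar_adj H hS Sl Sg.
  rewrite zgE (ip_linl H) // ?(ipBl H) ?(ipZl H) //; last exact: (spaceB H).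
  have BwL := spaceZ H w%:C Bl; have BSl := Sstar_in H hS Sl.
  move=> h.
  have -> : ip q l = ip g (A l) + (c^* * ip s l + (w%:C - v^*) * ip g l).
    rewrite /A (ipBr H) // (ipZr H) //; move: h; set x1 := ip g _; set x2 := ip g _.
    by move=> <-; ring.
  apply: le_trans (cabsD _ _) _; apply: lerD.
    apply: le_trans (cauchy_schwarz H Bg (BA _ Sl)) _.
    by rewrite ler_wpM2r ?hnorm_ge0.
  apply: le_trans tM; rewrite /M mulrDr; apply: le_trans (cabsD _ _) _; apply: lerD.
    rewrite cabsM cabsJ (_ : t * (_ * K) = (K * t) * (hnorm ip s * hnorm ip l)); last by ring.
    by rewrite ler_pM ?cabs_ge0 // (cauchy_schwarz H).
  have wv : cabs (w%:C - v^*) = t.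
    rewrite /v /cabs normc_def /= subrr expr0n /= add0r opprK add0r sqrtr_sqr.
    by rewrite ger0_norm // ltW.
  rewrite cabsM wv ler_wpM2l ?(ltW t0) //.
  apply: le_trans (cauchy_schwarz H Bg Bl) _.
  by rewrite ler_wpM2r ?hnorm_ge0.
have [||u Bu hu] := @riesz _ _ _ H domSstar A (ip q) N (domSstar0 H) (domSstar_lin H hS) BA _ _ bnd.
- move=> a f g Sf Sg; apply/funext => z; rewrite /A (Sstar_lin H hS) //; ring.
- by move=> a f g Sf Sg; rewrite (hilbert_ip_lin H) //; [exact: Sf.1|exact: Sg.1].
exists u => // z.
(* the kernel at [z] is an eigenvector: [A] multiplies it by [conj z - w] *)
have := hu _ (domSstar_kernel H hk z).
rewrite (_ : A _ = fun y => (z^* - w%:C) * k y z); last first.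
  by apply/funext => y; rewrite /A (Sstar_kernel H hk hS) mulrBl.
rewrite (ipZr H) ?(kernel_evalr H hk) //; last exact: (kernel_in hk).
move=> /(congr1 conjc); rewrite rmorphM /= !conjcK => ->.
by rewrite rmorphB /= conjcK oppr0.
Qed.

Lemma divide q s w : B q -> q w = 0 -> B s -> s w != 0 ->
  exists2 g, B g & forall z, (z - w) * g z = q z.
Proof.
have [|w0 Bq qw _ _] := eqVneq (complex.Im w) 0; last exact: divide_nonreal.
by case: w => x y /= ->; rewrite complexr0; exact: divide_real.
Qed.

Lemma entire_lin_mulz f g : entire f -> entire g -> entire (fun z => z * f z + g z).
Proof.
move=> fe ge z; apply: derivableD; last exact: ge.
by apply: derivableM; [exact: derivable_id | exact: fe].
Qed.

(** For [h = z f + g] the numerator of the difference quotient of [u] and [h] is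
    [- (z - w) u(w) f(z)] plus an element of [B] vanishing at [w], and the latter is
    divisible by [z - w]; since [h w <> 0], one of [f], [g] does not vanish at [w]. *)
Lemma assoc_lin_mulz f g : B f -> B g -> assoc B (fun z => z * f z + g z).
Proof.
move=> Bf Bg; split; first by apply: entire_lin_mulz; exact: Bentire.
move=> u w Bu hw.
have [s Bs sw] : exists2 s, B s & s w != 0.
  have [fw|fw] := eqVneq (f w) 0; last by exists f.
  by exists g => //; move: hw; rewrite fw mulr0 add0r.
pose q := fun z => (w * f w + g w) * u z - u w * (w * f z + g z).
have Bq : B q.
  by apply: (spaceB H); apply: (spaceZ H) => //; exact: (hilbert_lin H).
have qw : q w = 0 by rewrite /q; ring.
have [y By hy] := divide Bq qw Bs sw.
exists (fun z => - u w * f z + y z); first exact: (hilbert_lin H).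
by move=> z; rewrite mulrDr hy /q; ring.
Qed.

(** The difference quotient of [h] and [f] at [w] can be solved for [h] as soon as
    [f w <> 0]; a non-real [w] with [h w <> 0] exists by continuity, and at such a
    point some function of [B] does not vanish. *)
Lemma assoc_decomp h : assoc B h ->
  exists f g, [/\ B f, B g & h = fun z => z * f z + g z].
Proof.
move=> [he hh]; have [->|h0] := pselect (h = fun=> 0).
  exists (fun=> 0), (fun=> 0); split; try exact: (hilbert_zero H).
  by apply/funext => z; rewrite mulr0 addr0.
have [v hv] := ex_nonzero_point h0.
have [w w0 hw] := ex_nonzero_nonreal he hv.
have [f Bf fw] := ex_nonzero_at w0.
have [g Bg hg] := hh f w Bf hw.
exists (fun z => (- (f w)^-1) * g z), (fun z => (w / f w) * g z + (h w / f w) * f z).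
split; first exact: (spaceZ H).
- by apply: (hilbert_lin H) => //; exact: (spaceZ H).
apply/funext => z; apply: (mulfI fw).
have -> : f w * h z = h w * f z - (h w * f z - h z * f w) by ring.
by rewrite -hg; field.
Qed.

End Division.

(** * The completion and its pairing *)

Section DualPairing.
Context {R : realType} {B : set (R[i] -> R[i])}.
Context {ip : (R[i] -> R[i]) -> (R[i] -> R[i]) -> R[i]}.
Context {k : R[i] -> R[i] -> R[i]}.
Hypothesis H : is_hilbert B ip.
Hypothesis hk : reproducing_kernel B ip k.
Hypothesis hS : densely_defined B ip.
Context {X : completeNormedModType R[i]} {iota : (R[i] -> R[i]) -> X}.
Context {pair : X -> (R[i] -> R[i]) -> R[i]}.
Hypothesis hX : is_completion B ip iota.
Hypothesis hpair : is_pairing B ip iota pair.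
Local Notation C := R[i].
Local Notation Sstar := (Sstar B ip).
Local Notation domSstar := (domSstar B ip).
Local Notation plus_inner := (plus_inner B ip).
Local Notation plus_norm := (plus_norm B ip).
Local Notation minus_norm := (minus_norm B ip).
Implicit Types (f g h u b : C -> C) (a w z : C) (psi : X).

Let HF : is_hilbert domSstar plus_inner := hilbert_plus H hS.

(** The norm of the completion takes complex values; this is its real-valued
    counterpart. *)
Definition xnorm psi : R := complex.Re `|psi|.

Lemma xnormE psi : (xnorm psi)%:C = `|psi|.
Proof.
have := ger0_Im (normr_ge0 psi); rewrite /xnorm.
by case: `|psi| => x y /= ->.
Qed.

Lemma xnorm_ge0 psi : 0 <= xnorm psi.
Proof. by rewrite -ler0c xnormE. Qed.

Lemma xnorm_triangle psi2 psi1 psi3 :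
  xnorm (psi1 - psi3) <= xnorm (psi1 - psi2) + xnorm (psi2 - psi3).
Proof. by rewrite -lecR realcD !xnormE ler_distD. Qed.

Lemma xnormC psi1 psi2 : xnorm (psi1 - psi2) = xnorm (psi2 - psi1).
Proof. by rewrite /xnorm distrC. Qed.

Lemma iota0 : iota (fun=> 0) = 0.
Proof.
have B0 := hilbert_zero H; have := completion_lin hX 1 B0 B0.
rewrite (_ : (fun=> _) = (fun=> 0)); last by apply/funext => z; rewrite mulr0 addr0.
by rewrite scale1r -[X in X = _]addr0 => /addrI <-.
Qed.

Lemma iotaB f g : B f -> B g -> iota (fun z => f z - g z) = iota f - iota g.
Proof. by move=> Bf Bg; rewrite subE (completion_lin hX) // scaleN1r addrC. Qed.

Lemma xnorm_iota f g : B f -> B g ->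
  xnorm (iota f - iota g) = minus_norm (fun z => f z - g z).
Proof.
move=> Bf Bg; rewrite -iotaB // /xnorm (completion_norm hX) //.
exact: (spaceB H).
Qed.

Lemma completion_approx psi (eps : R) : 0 < eps ->
  exists2 b, B b & xnorm (psi - iota b) < eps.
Proof.
move=> e0; have e0' : 0 < eps%:C by rewrite -[0]/(0%:C) ltcR.
have [|x [+ [b Bb bE]]] := completion_dense hX _ (ball_open psi eps%:C).
  by exists psi; exact: ballxx.
by rewrite -ball_normE /= -bE => h; exists b; rewrite // -ltcR xnormE.
Qed.

(** Near [psi] the pairing is a limit of pairings with elements of [B], for which
    the estimate is the definition of the dual norm. The boundedness and linearity
    of [pair psi], and the limits of the surjectivity proof, all come from here. *)
Lemma pair_dist psi b g : B b -> domSstar g ->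
  cabs (pair psi g - ip b g) <= xnorm (psi - iota b) * plus_norm g.
Proof.
move=> Bb Sg; apply/ler_addgt0Pr => eps eps0.
have p0 : 0 <= plus_norm g := plus_norm_ge0 g.
have p1 : 0 < plus_norm g + 1 by rewrite ltr_wpDl.
pose t := eps / (plus_norm g + 1).
have t0 : 0 < t by rewrite divr_gt0.
have [d d0 hd] := pairing_continuous hpair psi Sg t0.
have [|b' Bb' hb'] := @completion_approx psi (Num.min t d); first by rewrite lt_min t0.
move: hb'; rewrite lt_min => /andP[ht hd'].
have h1 : cabs (pair psi g - ip b' g) < t.
  rewrite -ltcR cabsE distrC -(pairing_ext hpair Bb' Sg); apply: hd => //.
    by rewrite -xnormE ltcR xnormC.
  rewrite (_ : (fun z => _) = fun=> 0); last by apply/funext => z; rewrite subrr.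
  by rewrite /plus_norm (ip0r HF (domSstar0 H)) sqrtr0.
have h2 : cabs (ip b' g - ip b g) <= (xnorm (psi - iota b) + t) * plus_norm g.
  rewrite -(ipBl H Sg.1 Bb' Bb).
  apply: le_trans (ip_minus_bound H hS (spaceB H Bb' Bb) Sg) _.
  rewrite ler_wpM2r // -(xnorm_iota Bb' Bb).
  apply: le_trans (xnorm_triangle psi _ _) _.
  by rewrite addrC lerD2l xnormC ltW.
have -> : pair psi g - ip b g = (pair psi g - ip b' g) + (ip b' g - ip b g) by ring.
apply: le_trans (cabsD _ _) _; apply: le_trans (lerD (ltW h1) h2) _.
have : t * (plus_norm g + 1) = eps by rewrite /t divfK // gt_eqF.
by move=> <-; rewrite le_eqVlt; apply/orP; left; apply/eqP; ring.
Qed.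

Lemma pair_bound psi g : domSstar g -> cabs (pair psi g) <= xnorm psi * plus_norm g.
Proof.
move=> Sg; have := pair_dist psi (hilbert_zero H) Sg.
rewrite iota0 subr0 (hilbert_ip_conj H Sg.1 (hilbert_zero H)) (ip0r H) ?conjc0 ?subr0 //.
exact: Sg.1.
Qed.

Lemma pair_lin psi a f g : domSstar f -> domSstar g ->
  pair psi (fun z => a * f z + g z) = a * pair psi f + pair psi g.
Proof.
move=> Sf Sg; have Sh := domSstar_lin H hS a Sf Sg.
apply/eqP; rewrite -subr_eq0; apply/eqP.
apply: (@cabs_small_eq0 _ _ (plus_norm (fun z => a * f z + g z) +
  (cabs a * plus_norm f + plus_norm g))) => eps e0.
have [b Bb hb] := completion_approx psi e0.
have D h (Sh' : domSstar h) : cabs (pair psi h - ip b h) <= eps * plus_norm h.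
  apply: le_trans (pair_dist psi Bb Sh') _.
  by rewrite ler_wpM2r ?plus_norm_ge0 // ltW.
have -> : pair psi (fun z => a * f z + g z) - (a * pair psi f + pair psi g) =
  (pair psi (fun z => a * f z + g z) - ip b (fun z => a * f z + g z)) -
  (a * (pair psi f - ip b f) + (pair psi g - ip b g)).
  rewrite (hilbert_ip_lin H) //; [ring|exact: Sf.1|exact: Sg.1].
apply: le_trans (cabsB _ _) _; rewrite [leRHS]mulrDr; apply: lerD; first exact: D.
apply: le_trans (cabsD _ _) _; rewrite [leRHS]mulrDr; apply: lerD; last exact: D.
by rewrite cabsM mulrCA ler_wpM2l ?cabs_ge0 // D.
Qed.

(** Elements of the completion are separated by the pairing since the norm
    [minus_norm] is by definition the one dual to [plus_norm]. *)
Lemma pair_inj psi1 psi2 :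
  (forall g, domSstar g -> pair psi1 g = pair psi2 g) -> psi1 = psi2.
Proof.
move=> h; apply/eqP; rewrite -subr_eq0 -normr_eq0 -xnormE.
suff -> : xnorm (psi1 - psi2) = 0 by [].
apply: (@complexI R); apply: (@cabs_small_eq0 _ _ 4) => eps e0.
have [b1 Bb1 h1] := completion_approx psi1 e0.
have [b2 Bb2 h2] := completion_approx psi2 e0.
rewrite cabsR ger0_norm ?xnorm_ge0 //.
have h12 : xnorm (iota b1 - iota b2) <= eps + eps.
  rewrite xnorm_iota //; apply: (minus_norm_le H hS).
  - by rewrite addr_ge0 // ltW.
  - exact: (spaceB H).
  move=> g Sg; rewrite (ipBl H Sg.1) //.
  have -> : ip b1 g - ip b2 g = (pair psi2 g - ip b2 g) - (pair psi1 g - ip b1 g).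
    by rewrite h //; ring.
  apply: le_trans (cabsB _ _) _; rewrite mulrDl.
  apply: lerD; apply: le_trans (pair_dist _ _ Sg) _ => //;
    by rewrite ler_wpM2r ?plus_norm_ge0 // ltW.
have := xnorm_triangle (iota b1) psi1 psi2.
have := xnorm_triangle (iota b2) (iota b1) psi2.
rewrite (xnormC (iota b2) psi2); lra.
Qed.

Lemma pair_riesz psi :
  exists2 u, domSstar u & forall g, domSstar g -> pair psi g = plus_inner u g.
Proof.
apply: (riesz HF (L := domSstar) (A := id) (M := xnorm psi)) => //.
- exact: domSstar0.
- exact: domSstar_lin.
- exact: pair_lin.
- exact: pair_bound.
Qed.

Lemma plus_inner_kernel u z : domSstar u ->
  plus_inner u (k^~ z) = (z * Sstar u z + u z)^*.
Proof.
move=> Su; have BSu := Sstar_in H hS Su.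
rewrite /plus_inner (Sstar_kernel H hk hS) (ipZr H) ?(kernel_evalr H hk) //.
- by rewrite rmorphD rmorphM.
- exact: Su.1.
- exact: (kernel_in hk).
Qed.

(** A vanishing [z * S^* u + u] says that [S^* u] is in the domain of [S] and
    that [S S^* u = - u], whence ||S^* u||^2 = - ||u||^2. *)
Lemma plus_kernel_total u : domSstar u ->
  (forall z, plus_inner u (k^~ z) = 0) -> u = fun=> 0.
Proof.
move=> Su h; have BSu := Sstar_in H hS Su.
have zE : mulz (Sstar u) = fun z => (-1) * u z.
  apply/funext => z; have := h z; rewrite plus_inner_kernel //.
  move=> /(congr1 conjc); rewrite conjcK conjc0 /mulz => /eqP.
  by rewrite addr_eq0 => /eqP ->; rewrite mulN1r.
have SSu : domS B (Sstar u) by split => //; rewrite zE; exact: (spaceZ H _ Su.1).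
have := Sstar_adj H hS Su SSu; rewrite zE (ipZl H) ?rmorphN ?rmorph1 ?mulN1r //; try exact: Su.1.
move=> uu; apply: (hnorm0_eq0 HF) => //.
by rewrite /hnorm {1}/plus_inner -uu addNr sqrtr0.
Qed.

(** [psi1] and [psi2] are represented by vectors of the graph space, whose difference is
    orthogonal to all kernels. *)
Lemma pair_kernel_inj psi1 psi2 :
  (forall z, pair psi1 (k^~ z) = pair psi2 (k^~ z)) -> psi1 = psi2.
Proof.
move=> h; have [u1 Su1 h1] := pair_riesz psi1; have [u2 Su2 h2] := pair_riesz psi2.
apply: pair_inj => g Sg; rewrite h1 // h2 //; apply/eqP; rewrite -subr_eq0.
rewrite -(ipBl HF Sg Su1 Su2) (plus_kernel_total (domSstarB H hS Su1 Su2)).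
  by rewrite (hilbert_ip_conj HF Sg (domSstar0 H)) (ip0r HF Sg) conjc0.
move=> z; have Sk := domSstar_kernel H hk z.
by rewrite (ipBl HF Sk Su1 Su2) -h1 // -h2 // h subrr.
Qed.

(** Approximating [f] by elements [f_n] of the domain of [S], the functions
    [z * f_n + g] belong to [B], and they form a Cauchy sequence for the dual
    norm because multiplication by [z] is moved onto the other argument. *)
Lemma pair_kernel_surj f g : B f -> B g ->
  exists psi, forall z, pair psi (k^~ z) = (z * f z + g z)^*.
Proof.
move=> Bf Bg; pose d (n : nat) : R := n.+1%:R^-1.
have d0 n : 0 < d n by rewrite invr_gt0.
have /choice[f_ hf_] : forall n, exists u, domS B u /\ hnorm ip (fun z => f z - u z) < d n.
  by move=> n; have [u Su hu] := hS Bf (d0 n); exists u.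
have Sf n := (hf_ n).1; have Bf_ n : B (f_ n) := (Sf n).1.
pose b n := fun z => mulz (f_ n) z + g z.
have Bb n : B (b n) by exact: (spaceD H (Sf n).2 Bg).
have bd n m : xnorm (iota (b n) - iota (b m)) <= d n + d m.
  rewrite xnorm_iota //.
  have -> : (fun z => b n z - b m z) = mulz (fun z => f_ n z - f_ m z).
    by apply/funext => z; rewrite /b /mulz; ring.
  have Snm : domS B (fun z => f_ n z - f_ m z) by rewrite subE; exact: (domS_lin H).
  have nm : hnorm ip (fun z => f_ n z - f_ m z) <= d n + d m.
    apply: le_trans (hnorm_triangle H (Bf_ n) (Bf_ m) Bf) _.
    by rewrite (hnorm_subC H) // lerD // ltW // (hf_ _).2.
  apply: (minus_norm_le H hS); first by rewrite addr_ge0 // ltW.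
    exact: Snm.2.
  move=> h Sh; rewrite (Sstar_adj H hS) //.
  apply: le_trans (cauchy_schwarz H Snm.1 (Sstar_in H hS Sh)) _.
  by rewrite ler_pM ?hnorm_ge0 // (hnorm_Sstar_le_plus H hS).
have [psi hpsi] : exists psi, forall eps : R, 0 < eps ->
    exists N, forall n, (N <= n)%N -> xnorm (psi - iota (b n)) < eps.
  have cF : cauchy ((fun n => iota (b n)) @ \oo).
    apply/cauchy_exP => r r0.
    have rE := gt0_real_complex r0.
    have r0' : 0 < complex.Re r by move: r0; rewrite rE -[0]/(0%:C) ltcR.
    have [N hN] := inv_succ_small (divr_gt0 r0' (ltr0Sn R 1)).
    exists (iota (b N)), N => // n /= Nn; rewrite -ball_normE /= rE -xnormE ltcR.
    apply: le_lt_trans (bd _ _) _; rewrite (splitr (complex.Re r)).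
    by apply: ltrD; apply: hN.
  have /cvg_ex[psi hpsi] : cvg ((fun n => iota (b n)) @ \oo) by exact: cauchy_cvg.
  exists psi => eps e0; have e0' : 0 < eps%:C by rewrite -[0]/(0%:C) ltcR.
  have [N _ hN] := cvgr_dist_lt _ _ hpsi _ e0'.
  by exists N => n /hN; rewrite -ltcR xnormE.
exists psi => z; have Sk := domSstar_kernel H hk z; have Bk := kernel_in hk z.
apply/eqP; rewrite -subr_eq0; apply/eqP.
apply: (@cabs_small_eq0 _ _ (plus_norm (k^~ z) + cabs z * hnorm ip (k^~ z))) => eps e0.
have [N1 h1] := hpsi _ e0; have [N2 h2] := inv_succ_small e0.
have {h1} := h1 (maxn N1 N2) (leq_maxl _ _).
have {h2} := h2 (maxn N1 N2) (leq_maxr _ _).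
move: (maxn N1 N2) => n h2 h1.
have -> : pair psi (k^~ z) - (z * f z + g z)^* =
   (pair psi (k^~ z) - ip (b n) (k^~ z)) - (z * (f z - f_ n z))^*.
  by rewrite (kernel_evalr H hk) // /b /mulz !(rmorphM, rmorphD, rmorphN) /=; ring.
apply: le_trans (cabsB _ _) _; rewrite [leRHS]mulrDr; apply: lerD.
  apply: le_trans (pair_dist psi (Bb n) Sk) _.
  by rewrite ler_wpM2r ?plus_norm_ge0 // ltW.
rewrite cabsJ cabsM mulrCA ler_wpM2l ?cabs_ge0 //.
apply: le_trans (eval_bound H hk z (spaceB H Bf (Bf_ n))) _.
by rewrite ler_wpM2r ?hnorm_ge0 // ltW // (lt_trans (hf_ n).2).
Qed.

End DualPairing.

(** * The bijection *)

Theorem proposition3p4 (R : realType)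
  (B : set (R[i] -> R[i])) (ip : (R[i] -> R[i]) -> (R[i] -> R[i]) -> R[i])
  (e : R[i] -> R[i]) (k : R[i] -> R[i] -> R[i])
  (hdB : is_dB_space B ip)
  (hB0 : exists2 f, B f & f <> (fun=> 0%R))
  (heHB : hermite_biehler e)
  (he0 : no_real_zeros e)
  (hBe : B = dB_of e)
  (hipe : forall f g, B f -> B g -> ip f g = dB_inner e f g)
  (hk : reproducing_kernel B ip k)
  (hS : densely_defined B ip)
  (Fminus : completeNormedModType R[i]) (iota : (R[i] -> R[i]) -> Fminus)
  (hF : is_completion B ip iota)
  (pair : Fminus -> (R[i] -> R[i]) -> R[i])
  (hpair : is_pairing B ip iota pair) :
  set_bij [set: Fminus]%classic (assoc B)
    (fun psi : Fminus => fun z : R[i] => pairing_rev pair (k^~ z) psi).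
Proof.
have H := dB_hilbert hdB.
split.
- move=> psi _; have [u Su hu] := pair_riesz H hS hF hpair psi.
  rewrite (_ : (fun z => _) = fun z => z * Sstar B ip u z + u z).
    apply: (assoc_lin_mulz hdB heHB.1 he0 hipe hk hS _ Su.1).
    exact: (Sstar_in H hS Su).
  apply/funext => z; rewrite /pairing_rev hu; last exact: (domSstar_kernel H hk z).
  by rewrite (plus_inner_kernel H hk hS) // conjcK.
- move=> psi1 psi2 _ _ /= h; apply: (pair_kernel_inj H hk hS hF hpair) => z.
  have := congr1 (@^~ z) h; rewrite /= /pairing_rev => hz.
  by apply: (can_inj (@conjcK R)).
- move=> h hh; have [f [g [Bf Bg hE]]] := assoc_decomp hdB hB0 hipe hk hh.
  have [psi hpsi] := pair_kernel_surj H hk hS hF hpair Bf Bg.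
  exists psi => //; apply/funext => z.
  by rewrite /pairing_rev hpsi conjcK hE.
Qed.
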